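(* Every double cover of $\{0,1,2\}^6$ has at least $60$ boxes; that is, $f(6)\ge 60$.
   Context: Write $[3]=\{0,1,2\}$. A proper sub-box of $[3]^d$ is a set $B=S_1\times\dots\times S_d$ with $\varnothing\neq S_i\subsetneq[3]$ for every $1\le i\le d$ (so each side $S_i$ has one or two elements). A double cover of $[3]^d$ is a finite multiset $\{B_1,\dots,B_m\}$ of proper sub-boxes such that every point of $[3]^d$ lies in exactly two of the $B_j$, counted with multiplicity; its size is $m$. $f(d)$ denotes the minimum size of a double cover of $[3]^d$. *)

(* Defs.v *)
From mathcomp Require Import all_boot.

Set Implicit Arguments.
Unset Strict Implicit.
Unset Printing Implicit Defensive.

Definition point (d : nat) := {ffun 'I_d -> 'I_3}.

Definition box (d : nat) (S : {ffun 'I_d -> {set 'I_3}}) : {set point d} :=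
  [set x : point d | [forall i, x i \in S i]].

Definition proper_sub_box (d : nat) (B : {set point d}) : bool :=
  [exists S : {ffun 'I_d -> {set 'I_3}},
     [forall i, (S i != set0) && (S i \proper [set: 'I_3])] && (B == box S)].

(* The finite multiset of boxes is represented by a sequence: repetitions are
   allowed, and the predicate is invariant under permutation. *)
Definition double_cover (d : nat) (s : seq {set point d}) : bool :=
  all (@proper_sub_box d) s &&
  [forall x : point d, count (fun B : {set point d} => x \in B) s == 2].

Definition has_double_cover (d m : nat) : bool :=
  [exists s : m.-tuple {set point d}, double_cover s].

Lemma has_double_coverP (d m : nat) :
  reflect (exists2 s : seq {set point d}, double_cover s & size s = m)
          (has_double_cover d m).
Proof.
apply: (iffP existsP) => [[t ht]|[s hs <-]].
  by exists t; rewrite ?size_tuple.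
by exists (in_tuple s).
Qed.

(* All singletons, each taken twice, form a double cover. *)
Lemma exists_double_cover (d : nat) : exists m, has_double_cover d m.
Proof.
pose e := [seq [set x] | x <- enum {: point d}].
have hp : all (@proper_sub_box d) e.
  apply/allP => _ /mapP[x _ ->]; apply/existsP.
  exists [ffun i => [set x i]]; apply/andP; split.
    apply/forallP => i; rewrite ffunE properEcard subsetT cardsT card_ord cards1.
    by rewrite -card_gt0 cards1.
  apply/eqP/setP => y; rewrite !inE; apply/eqP/forallP => [-> i|h].
    by rewrite ffunE inE.
  by apply/ffunP => i; move: (h i); rewrite ffunE inE => /eqP.
exists (size (e ++ e)); apply/has_double_coverP; exists (e ++ e) => //.
rewrite /double_cover all_cat hp; apply/forallP => x.
rewrite count_cat count_map (eq_count (a2 := pred1 x)); last first.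
  by move=> y; rewrite /= inE eq_sym.
by rewrite count_uniq_mem ?enum_uniq // mem_enum.
Qed.

Definition f (d : nat) : nat := ex_minn (exists_double_cover d).

(* Main.v *)
(** For each coordinate pick an integer functional that takes an odd value on
    the full side, and apply the product functional to the identity
    "the sum of the indicators of the boxes is 2": the values at the boxes sum
    to 2 modulo 4.  Hence either two of them are odd or one of them is 2 modulo
    4, i.e. they have total cost at least 2, where odd values cost 1, values
    that are 2 modulo 4 cost 2, and multiples of 4 cost 0.  The functionals are
    the three evaluations, which favour one-point sides, and the three sums
    x(a) + x(b) - x(c), which are odd on one-point sides and even on two-point
    sides.  Averaging over all products of these with a suitable nonnegative
    weight, each single box has average cost less than 2/60. *)
Require Import Defs.
From mathcomp Require Import all_boot.
From mathcomp Require Import order ssralg ssrnum ssrint.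
From mathcomp Require Import ring zify.

Set Implicit Arguments.
Unset Strict Implicit.
Unset Printing Implicit Defensive.

Import Order.TTheory GRing.Theory Num.Theory.

(** * Parity and residue 2 modulo 4 of products and sums *)

Definition twice_odd (n : nat) : bool := n %% 4 == 2.

Definition cost (n : nat) : nat := odd n + 2 * twice_odd n.

Lemma twice_oddM (m n : nat) :
  twice_odd (m * n) = twice_odd m * odd n + odd m * twice_odd n :> nat.
Proof.
have odd4 k : odd (k %% 4) = odd k by rewrite {2}(divn_eq k 4) oddD oddM andbF.
rewrite /twice_odd -modnMm -(odd4 m) -(odd4 n).
have := ltn_pmod m (isT : 0 < 4); have := ltn_pmod n (isT : 0 < 4).
by case: (m %% 4) => [|[|[|[|]]]] //; case: (n %% 4) => [|[|[|[|]]]].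
Qed.

Lemma odd_prod (I : Type) (r : seq I) (n : I -> nat) :
  odd (\prod_(i <- r) n i) = \prod_(i <- r) odd (n i) :> nat.
Proof.
apply: (big_morph (fun k => nat_of_bool (odd k))) => // a b.
by rewrite oddM mulnb.
Qed.

(** Residue 2 modulo 4 means one factor is 2 modulo 4 and all others are odd. At most one position
    qualifies, so a sum expresses the disjunction; [uniq] makes [j == i] single out one position. *)
Lemma twice_odd_prod (I : eqType) (r : seq I) (n : I -> nat) : uniq r ->
  twice_odd (\prod_(i <- r) n i) =
  \sum_(i <- r) \prod_(j <- r) (if j == i then twice_odd (n j) else odd (n j))
  :> nat.
Proof.
elim: r => [|a r IHr] /=; first by rewrite !big_nil.
case/andP=> ar /IHr {}IHr; rewrite big_cons twice_oddM IHr big_cons; congr addn.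
  rewrite big_cons eqxx odd_prod; congr muln.
  rewrite [LHS]big_seq_cond [RHS]big_seq_cond; apply: eq_bigr => j /andP[jr _].
  by case: eqP ar jr => // ->; case: (a \in r).
rewrite big_distrr /= big_seq_cond [RHS]big_seq_cond.
apply: eq_bigr => i /andP[ir _].
by rewrite big_cons; case: eqP ar ir => // ->; case: (i \in r).
Qed.

(** [cost] preserves parity, so the total cost is even; it is nonzero, since cost 0 means divisible
    by 4. *)
Lemma leq2_sum_cost (T : Type) (s : seq T) (n : T -> nat) :
  \sum_(t <- s) n t = 2 %[mod 4] -> 2 <= \sum_(t <- s) cost (n t).
Proof.
move=> n2.
have evenS : ~~ odd (\sum_(t <- s) cost (n t)).
  have -> : odd (\sum_(t <- s) cost (n t)) = odd (\sum_(t <- s) n t).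
    elim: {n2} s => [|t s IHs]; rewrite ?big_nil // !big_cons oddD IHs.
    by rewrite [odd (_ + _)]oddD /cost oddD oddM addbF oddb.
  by rewrite (divn_eq (\sum_(t <- s) n t) 4) n2 oddD oddM andbF.
suff : \sum_(t <- s) cost (n t) != 0.
  by case: (\sum_(t <- s) _) evenS => [|[|]].
apply/eqP => S0; have : 4 %| \sum_(t <- s) n t; last by rewrite /dvdn n2.
elim: s S0 {n2 evenS} => [|t s IHs]; rewrite ?big_nil // !big_cons.
move/eqP; rewrite addn_eq0 => /andP[nt /eqP /IHs ?]; rewrite dvdn_add // /dvdn.
move: nt; rewrite /cost /twice_odd {1}(divn_eq (n t) 4) oddD oddM andbF /=.
by have := ltn_pmod (n t) (isT : 0 < 4); case: (n t %% 4) => [|[|[|[|]]]].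
Qed.

(** * Functionals on one coordinate and their weighted averages *)

(* (false, a) encodes the evaluation [x |-> x(a)], and (true, c) the functional
   [x |-> x(0) + x(1) + x(2) - 2 x(c)], with [-1] replaced by [3] modulo 4. *)
Definition functional : finType := (bool * 'I_3)%type.

Definition density (u : functional) (x : 'I_3) : nat :=
  if u.1 then 1 + 2 * (x == u.2) else x == u.2.

Definition mass (u : functional) (S : {set 'I_3}) : nat :=
  \sum_(x in S) density u x.

Lemma massF (a : 'I_3) (S : {set 'I_3}) : mass (false, a) S = (a \in S).
Proof.
rewrite /mass /density /=; case: (boolP (a \in S)) => aS; last first.
  by apply: big1 => x xS; case: eqP xS aS => // ->; case: (a \in S).
by rewrite (bigD1 a) //= eqxx big1 // => x /andP[_ /negbTE ->].
Qed.

Lemma massT (c : 'I_3) (S : {set 'I_3}) :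
  mass (true, c) S = #|S| + 2 * (c \in S).
Proof. by rewrite /mass /density /= big_split sum1_card -big_distrr -massF. Qed.

Local Open Scope ring_scope.

Lemma prodr_if d (P : pred 'I_d) (a b : int) :
  \prod_i (if P i then a else b) =
  a ^+ #|[set i | P i]| * b ^+ (d - #|[set i | P i]|).
Proof.
rewrite (bigID P) /=; congr (_ * _).
  by rewrite (eq_bigr (fun=> a)) => [|i ->]; rewrite ?prodr_const ?cardsE.
rewrite (eq_bigr (fun=> b)) => [|i /negbTE -> //]; rewrite prodr_const cardsE.
by congr (_ ^+ _); rewrite -[X in (X - _)%N]card_ord -(cardC P) addKn.
Qed.

(** The values -1, 0, 3 of [v] used below give the weight ratios -1/6, 0, 1/2, with common
    denominator 6. *)
Definition weight (v : int) (u : functional) : int := if u.1 then v else 6.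

Lemma sum_functional (F : functional -> int) :
  \sum_u F u = \sum_a F (false, a) + \sum_c F (true, c).
Proof.
rewrite (eq_bigr (fun u => F (u.1, u.2))); last by case.
by rewrite -(pair_bigA _ (fun b a => F (b, a))) big_bool addrC.
Qed.

Lemma sum_weight (v : int) : \sum_u weight v u = 18 + 3 * v.
Proof.
by rewrite sum_functional /weight /= !sumr_const card_ord; ring.
Qed.

Lemma sum_mem (S : {set 'I_3}) : \sum_a (a \in S)%:R = #|S|%:R :> int.
Proof.
rewrite -sum1_card natr_sum [RHS]big_mkcond /=.
by apply: eq_bigr => a _; case: ifP.
Qed.

Section ProperSide.

Variables (v : int) (S : {set 'I_3}).
Hypotheses (S0 : S != set0) (S1 : S \proper [set: 'I_3]).

Let cardS : #|S| = 1%N \/ #|S| = 2%N.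
Proof.
have := proper_card S1; rewrite cardsT card_ord; move: S0; rewrite -card_gt0.
by case: #|S| => [|[|[|]]] //; [left | right].
Qed.

Lemma sum_weight_odd :
  \sum_u weight v u * (odd (mass u S))%:R =
  if #|S| == 2%N then 12 else 6 + 3 * v.
Proof.
rewrite sum_functional /weight /= -!mulr_sumr.
under eq_bigr do rewrite massF oddb.
under [X in _ + v * X]eq_bigr do rewrite massT oddD oddM addbF.
by rewrite sum_mem sumr_const card_ord; case: cardS => -> /=; ring.
Qed.

(** Evaluations give 0 or 1. On a two-point side [mass (true, c) S] is 2 for the one [c] outside [S]
    and 4 otherwise; on a one-point side it is odd. *)
Lemma sum_weight_twice_odd :
  \sum_u weight v u * (twice_odd (mass u S))%:R = if #|S| == 2%N then v else 0.
Proof.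
rewrite sum_functional /weight /= -!mulr_sumr big1 ?mulr0 ?add0r; last first.
  by move=> a _; rewrite massF; case: (a \in S).
under eq_bigr do rewrite massT.
case: cardS => cS; rewrite cS /=.
  by rewrite big1 ?mulr0 // => c _; case: (c \in S).
rewrite (eq_bigr (fun c => (c \in ~: S)%:R)); last first.
  by move=> c _; rewrite inE; case: (c \in S).
by rewrite sum_mem cardsCs setCK cS card_ord mulr1.
Qed.

End ProperSide.

(** * Product functionals on boxes *)

Definition total_weight d (v : int) (phi : {ffun 'I_d -> functional}) : int :=
  \prod_i weight v (phi i).

Lemma sum_total_weight d (v : int) :
  \sum_(phi : {ffun 'I_d -> functional}) total_weight v phi = (18 + 3 * v) ^+ d :> int.
Proof.
rewrite /total_weight -(bigA_distr_bigA (fun (i : 'I_d) u => weight v u)) /=.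
by rewrite prodr_const sum_weight card_ord.
Qed.

(** The sums factor over the coordinates. For residue 2, one two-point side contributes [v] instead
    of 12, which gives [p * v / 12] times the odd part; cost 2 doubles this, and the leading 6
    clears the denominator. *)
Lemma sum_total_weight_cost d (v : int) (S : {ffun 'I_d -> {set 'I_3}}) :
    (forall i, (S i != set0) && (S i \proper [set: 'I_3])) ->
    let p := #|[set i | #|S i| == 2%N]| in
  6 * \sum_(phi : {ffun 'I_d -> functional})
    total_weight v phi * (cost (\prod_i mass (phi i) (S i))%N)%:R =
  (6 + v *+ p) * 12 ^+ p * (6 + 3 * v) ^+ (d - p).
Proof.
move=> properS p.
have prod_odd : \prod_i (if #|S i| == 2%N then 12 else 6 + 3 * v) =
    12 ^+ p * (6 + 3 * v) ^+ (d - p) :> int.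
  exact: prodr_if.
have sum_odd : \sum_(phi : {ffun 'I_d -> functional})
      total_weight v phi * (odd (\prod_i mass (phi i) (S i))%N)%:R =
    12 ^+ p * (6 + 3 * v) ^+ (d - p).
  rewrite -prod_odd.
  under [LHS]eq_bigr do rewrite odd_prod natr_prod /total_weight -big_split /=.
  rewrite -(bigA_distr_bigA (fun i u => weight v u * (odd (mass u (S i)))%:R)) /=.
  by apply: eq_bigr => i _; case/andP: (properS i) => ? ?; rewrite sum_weight_odd.
have sum_twice :
    12 * \sum_(phi : {ffun 'I_d -> functional})
      total_weight v phi * (twice_odd (\prod_i mass (phi i) (S i))%N)%:R =
    v *+ p * (12 ^+ p * (6 + 3 * v) ^+ (d - p)).
  under eq_bigr do
    rewrite twice_odd_prod ?index_enum_uniq // natr_sum mulr_sumr.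
  rewrite exchange_big mulr_sumr /=.
  transitivity (\sum_(i in [set i | #|S i| == 2%N])
      v * (12 ^+ p * (6 + 3 * v) ^+ (d - p))); last first.
    by rewrite sumr_const [RHS]mulrnAl.
  rewrite [RHS]big_mkcond /=; apply: eq_bigr => i _.
  under eq_bigr do rewrite natr_prod /total_weight -big_split /=.
  rewrite -(bigA_distr_bigA (fun j u => weight v u *
    (if j == i then twice_odd (mass u (S j)) else odd (mass u (S j)) : bool)%:R)) /=.
  rewrite (bigD1 i) //= eqxx.
  case/andP: (properS i) => ? ?; rewrite sum_weight_twice_odd // inE.
  case: ifP => Si; last by rewrite mul0r mulr0.
  rewrite -prod_odd [in RHS](bigD1 i) //= Si mulrCA; congr (_ * (_ * _)).
  apply: eq_bigr => j /negbTE ji; rewrite ji.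
  by case/andP: (properS j) => ? ?; rewrite sum_weight_odd.
under eq_bigr do rewrite /cost natrD natrM mulrDr mulrCA.
have regroup (a b : int) : 6 * (a + 2 * b) = 6 * a + 12 * b by ring.
rewrite big_split /= -mulr_sumr regroup sum_odd sum_twice.
by ring.
Qed.

Lemma total_weightE d (v : int) (phi : {ffun 'I_d -> functional}) :
  let k := #|[set i | (phi i).1]| in total_weight v phi = v ^+ k * 6 ^+ (d - k).
Proof. exact: prodr_if. Qed.

Definition box_mass d (phi : {ffun 'I_d -> functional}) (B : {set point d}) : nat :=
  \sum_(x in B) \prod_i density (phi i) (x i).

Lemma box_massE d (phi : {ffun 'I_d -> functional})
    (S : {ffun 'I_d -> {set 'I_3}}) :
  box_mass phi (box S) = (\prod_i mass (phi i) (S i))%N.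
Proof.
rewrite /mass bigA_distr_big_dep; apply: eq_bigl => x.
by rewrite inE; apply/forallP/familyP.
Qed.

(** Each point is counted twice, and every [density] has total 1 or 5, hence 1 modulo 4. *)
Lemma sum_box_mass d (s : seq {set point d}) (phi : {ffun 'I_d -> functional}) :
  double_cover s -> (\sum_(B <- s) box_mass phi B = 2 %[mod 4])%N.
Proof.
case/andP=> _ /forallP cover2.
have -> : (\sum_(B <- s) box_mass phi B)%N =
          (2 * \prod_i \sum_x density (phi i) x)%N.
  rewrite bigA_distr_bigA big_distrr /=.
  under eq_bigr do rewrite /box_mass big_mkcond /=.
  rewrite exchange_big /=; apply: eq_bigr => x _.
  by rewrite -big_mkcond big_const_seq iter_addn_0 mulnC (eqP (cover2 x)).
rewrite -modnMmr.
suff -> : ((\prod_i \sum_x density (phi i) x) %% 4 = 1)%N by [].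
apply: (big_ind (fun n => n %% 4 = 1)%N) => // [m n m1 n1|i _].
  by rewrite -modnMm m1 n1.
by case: (phi i) => [[] c]; rewrite /density !big_ord_recr big_ord0 /=;
  case: c => [[|[|[|]]]].
Qed.

(** * The mixture in dimension six and the final count *)

(* [total_weight (-1)] takes negative values, but the mixture does not.  The
   constants were found by linear programming: a box with [p] two-point sides
   has the largest average cost for [p = 3], which gives the bound 60.65. *)
Definition mixture (phi : {ffun 'I_6 -> functional}) : int :=
  3 * total_weight (-1) phi + total_weight 0 phi + total_weight 3 phi.

Lemma mixture_ge0 phi : 0 <= mixture phi.
Proof.
rewrite /mixture !total_weightE; set k := #|_|.
have : (k <= 6)%N by rewrite -[6%N]card_ord max_card.
(* The value is [6^(6-k) (3 (-1)^k + 0^k + 3^k)], which is 0 at [k = 1] and positive otherwise. *)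
case: k => [|[|[|[|[|[|[|k]]]]]]] le6; last discriminate le6.
all: rewrite ?subSS subn0; lia.
Qed.

Lemma sum_mixture : \sum_phi mixture phi = 3 * 15 ^+ 6 + 18 ^+ 6 + 27 ^+ 6.
Proof.
rewrite /mixture !big_split /= -mulr_sumr !sum_total_weight.
by ring.
Qed.

(** The right side is the value at [p = 3], where [6 + v *+ p] and [6 + 3 * v] both equal 3, 6, 15
    for the three [v]. *)
Lemma sum_mixture_cost (B : {set point 6}) : proper_sub_box B ->
  6 * \sum_phi mixture phi * (cost (box_mass phi B))%:R
  <= 12 ^+ 3 * (3 ^+ 5 + 6 ^+ 4 + 15 ^+ 4).
Proof.
case/existsP=> S /andP[/forallP properS /eqP ->].
have distr (a b c k : int) : (3 * a + b + c) * k = 3 * (a * k) + b * k + c * k.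
  by ring.
under eq_bigr do rewrite box_massE /mixture distr.
have regroup (a b c : int) : 6 * (3 * a + b + c) = 3 * (6 * a) + 6 * b + 6 * c.
  by ring.
rewrite !big_split /= -mulr_sumr regroup.
rewrite !sum_total_weight_cost //; set p := #|_|.
have : (p <= 6)%N by rewrite -[6%N]card_ord max_card.
case: p => [|[|[|[|[|[|[|p]]]]]]] le6; last discriminate le6.
all: rewrite ?subSS subn0; lia.
Qed.

Lemma double_cover_size (s : seq {set point 6}) :
  double_cover s -> (60 <= size s)%N.
Proof.
move=> cover_s.
have lower : 2 * \sum_phi mixture phi <=
    \sum_(B <- s) \sum_phi mixture phi * (cost (box_mass phi B))%:R.
  rewrite exchange_big mulr_sumr; apply: ler_sum => phi _ /=.
  rewrite -mulr_sumr -natr_sum mulrC ler_wpM2l ?mixture_ge0 // ler_nat.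
  exact/leq2_sum_cost/sum_box_mass.
have upper (C : int) :
    (forall B, proper_sub_box B ->
       6 * \sum_phi mixture phi * (cost (box_mass phi B))%:R <= C) ->
    6 * \sum_(B <- s) \sum_phi mixture phi * (cost (box_mass phi B))%:R
    <= (size s)%:R * C.
  move=> boundC; have -> : (size s)%:R * C = \sum_(B <- s) C.
    by rewrite big_const_seq iter_addr_0 count_predT mulr_natl.
  rewrite mulr_sumr big_seq [leRHS]big_seq; apply: ler_sum => B Bs.
  by case/andP: cover_s => /allP /(_ B Bs) /boundC.
have {}upper := upper _ sum_mixture_cost.
(* Together, 12 times the total weight is at most the size times the bound for one box, which fails
   below 60. *)
rewrite sum_mixture in lower; rewrite leqNgt; apply/negP => small.
move: (\sum_(B <- s) _) (size s) lower upper small => m n; lia.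
Qed.

Local Close Scope ring_scope.

Theorem theorem5p2 :
  (forall s : seq {set point 6}, double_cover s -> 60 <= size s) /\ 60 <= f 6.
Proof.
split; first exact: double_cover_size.
rewrite /f; case: ex_minnP => m /has_double_coverP[s cover_s <-] _.
exact: double_cover_size.
Qed.
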